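(* Let $\mathbb{F}$ be a field, $n\ge 1$, and for $1\le i\le n$ let $B_i$ be an incomplete matrix over $\mathbb{F}$ and $v_i$ an incomplete column vector over $\mathbb{F}$ with the same number of rows as $B_i$. Let $$M=\begin{pmatrix} v_1 & B_1 & ? & \cdots & ?\\ v_2 & ? & B_2 & \cdots & ?\\ \vdots & \vdots & & \ddots & \vdots\\ v_n & ? & ? & \cdots & B_n\end{pmatrix},$$ where every block marked $?$ consists entirely of unknown entries. Assume that the first column $\begin{pmatrix} v_1\\ \vdots\\ v_n\end{pmatrix}$ of $M$ is not a junk column. Then $$mr(M)=\max_{1\le i\le n}\bigl(mr([v_i\,|\,B_i])+zero(v_i,B_i)\bigr).$$
   Context: An incomplete matrix (or vector) over a field $\mathbb{F}$ is a finite-size matrix (vector) each of whose entries is either a known element of $\mathbb{F}$ or unknown (written $?$). A completion of $M$ is a matrix over $\mathbb{F}$ of the same size that agrees with $M$ at all known entries; $S(M)$ is the set of completions of $M$, and $mr(M)=\min_{\bar M\in S(M)}\mathrm{rank}\,\bar M$. A column is a junk column if each of its entries is either the known value $0$ or unknown. For an incomplete column vector $u$ and an incomplete matrix $A$ with the same number of rows, $[u\,|\,A]$ is the matrix obtained by adjoining $u$ as a first column to $A$. Define $zero(u,A)=1$ if every completion $[\bar u\,|\,\bar A]\in S([u\,|\,A])$ with $\mathrm{rank}[\bar u\,|\,\bar A]=mr([u\,|\,A])$ satisfies $\bar u=0$; otherwise $zero(u,A)=0$. *)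

(* Defs.v *)
From HB Require Import structures.
From mathcomp Require Import all_boot all_order all_algebra.
From mathcomp Require Import boolp.

Set Implicit Arguments.
Unset Strict Implicit.
Unset Printing Implicit Defensive.

Import GRing.Theory.
Local Open Scope ring_scope.

(* An incomplete m x n matrix over F is an element of 'M[option F]_(m, n):
   [Some a] is the known entry a, [None] is the unknown entry "?". *)

Definition unknown_mx (F : fieldType) (m n : nat) : 'M[option F]_(m, n) :=
  const_mx None.

Definition completion (F : fieldType) (m n : nat)
    (M : 'M[option F]_(m, n)) (A : 'M[F]_(m, n)) : Prop :=
  forall i j a, M i j = Some a -> A i j = a.

Definition completion_rank (F : fieldType) (m n : nat)
    (M : 'M[option F]_(m, n)) : pred nat :=
  fun r => `[< exists2 A : 'M[F]_(m, n), completion M A & \rank A = r >].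

Lemma completion_rank_ex (F : fieldType) (m n : nat)
    (M : 'M[option F]_(m, n)) : exists r, completion_rank M r.
Proof.
exists (\rank (\matrix_(i, j) odflt 0 (M i j) : 'M[F]_(m, n))).
apply/asboolP; exists (\matrix_(i, j) odflt 0 (M i j)) => // i j a Mij.
by rewrite mxE Mij.
Qed.

Definition mr (F : fieldType) (m n : nat) (M : 'M[option F]_(m, n)) : nat :=
  ex_minn (completion_rank_ex M).

Definition junk (F : fieldType) (m : nat) (u : 'cV[option F]_m) : Prop :=
  forall i, u i 0 = Some 0 \/ u i 0 = None.

Definition zero (F : fieldType) (m n : nat)
    (u : 'cV[option F]_m) (A : 'M[option F]_(m, n)) : nat :=
  `[< forall (ubar : 'cV[F]_m) (Abar : 'M[F]_(m, n)),
        completion (row_mx u A) (row_mx ubar Abar) ->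
        \rank (row_mx ubar Abar) = mr (row_mx u A) ->
        ubar = 0 >].

(* Block (i, j) is B i when i = j, transported along i = j so that it has
   k j columns, and is entirely unknown otherwise. *)
Definition diag_block (F : fieldType) (n : nat) (m k : 'I_n -> nat)
    (B : forall i, 'M[option F]_(m i, k i)) (i j : 'I_n) :
    'M[option F]_(m i, k j) :=
  match i =P j with
  | ReflectT e => castmx (erefl (m i), congr1 k e) (B i)
  | ReflectF _ => unknown_mx F (m i) (k j)
  end.

Definition shared_column_mx (F : fieldType) (n : nat) (m k : 'I_n -> nat)
    (v : forall i, 'cV[option F]_(m i))
    (B : forall i, 'M[option F]_(m i, k i)) :
    'M[option F]_(\sum_(i < n) m i, 1 + \sum_(i < n) k i) :=
  row_mx (\mxcol_(i < n) v i)
         (\mxblock_(i < n, j < n) diag_block B i j).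

(* Main.v *)
(* Lower bound: deleting rows of a completion on which the nonzero first
   column vanishes strictly decreases the rank.  Upper bound: with r the
   maximum, each [v_i | B_i] has a completion [u_i | X_i] whose columns all
   lie in the column span of some [u_i | Y_i] with r columns; stacking the
   matrices [u_i | Y_i] gives r columns spanning a completion of the whole
   matrix, with first column the stack of the u_i. *)
Require Import Defs.
From mathcomp Require Import all_boot all_order all_algebra.
From mathcomp Require Import boolp.

Set Implicit Arguments.
Unset Strict Implicit.
Unset Printing Implicit Defensive.

Import GRing.Theory.
Local Open Scope ring_scope.

Section RankLemmas.
Variable F : fieldType.

(** Were the ranks equal, [A] would be [Q *m (P *m A)] for some [Q], and [P *m A *m c = 0] would
    force [A *m c = 0]. *)
Lemma mxrank_mulmx_lt (p m n : nat) (P : 'M[F]_(p, m)) (A : 'M[F]_(m, n))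
    (c : 'cV[F]_n) :
  A *m c != 0 -> P *m A *m c = 0 -> (\rank (P *m A) < \rank A)%N.
Proof.
move=> Ac0 PAc0; rewrite (ltn_leqif (mxrank_leqif_sup (submxMl P A))).
apply: contra Ac0 => /submxP[Q ->].
by rewrite -(mulmxA Q) PAc0 mulmx0.
Qed.

Lemma mxrank_mxsub_row_mx (p q m k : nat) (f : 'I_p -> 'I_m) (g : 'I_q -> 'I_k)
    (u : 'cV[F]_m) (W : 'M[F]_(m, k)) :
  u != 0 ->
  (\rank (row_mx (mxsub f id u) (mxsub f g W)) + (mxsub f id u == 0%R)
     <= \rank (row_mx u W))%N.
Proof.
move=> u0; set D := row_mx _ (mxsub f g W).
have -> : mxsub f id u = mxsub f id 1%:M *m u by rewrite -rowsubE.
have leD : (\rank D <= \rank (mxsub f id 1%:M *m row_mx u W))%N.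
  (* [mxrankS] compares row spaces, so transposing turns the dropping of columns into an
     inclusion. *)
  rewrite -rowsubE -mxrank_tr -[X in (_ <= X)%N]mxrank_tr mxrankS //.
  have -> : mxsub f id (row_mx u W) = row_mx (mxsub f id u) (mxsub f id W).
    by apply/matrixP=> i j; rewrite !mxE; case: splitP => l _; rewrite mxE.
  rewrite !tr_row_mx -!addsmxE addsmxS //.
  by rewrite trmx_mxsub trmx_mxsub -[mxsub g f _]/(mxsub (id \o g) f _)
    -[f]/(f \o id) mxsub_comp rowsub_sub.
case: eqP => [Pu0|_]; last first.
  by rewrite addn0 (leq_trans leD) // mxrankM_maxr.
rewrite addn1 (leq_ltn_trans leD) //.
(* The first basis vector extracts the first column, which is nonzero before the row selection and
   zero after it. *)
apply: (@mxrank_mulmx_lt _ _ _ _ _ (col_mx 1%:M 0)).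
  by rewrite mul_row_col mulmx1 mulmx0 addr0.
by rewrite -mulmxA mul_row_col mulmx1 mulmx0 addr0.
Qed.

(** A complement [D] in [X] of the intersection of [X] and [u] has rank [\rank (u + X) - \rank u],
    and [\rank u] is 1 unless [u] is zero. The hypothesis thus bounds the rank of [D] by [r], so [r]
    rows suffice to span [D]. *)
Lemma submx_row_extension (m k r : nat) (u : 'rV[F]_m) (X : 'M[F]_(k, m)) :
  (\rank (u + X)%MS + (u == 0%R) <= r.+1)%N ->
  exists Y : 'M[F]_(r, m), (X <= u + Y)%MS.
Proof.
move=> rk; pose D := (X :\: u)%MS.
have leD : (\rank D <= r)%N.
  have /eqP := mxrank_sum_cap X u; rewrite -(mxrank_cap_compl X u) rank_rV.
  rewrite addnC -addnA eqn_add2l addsmxC => /eqP rkD; move: rk; rewrite rkD.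
  by case: (u == 0%R); rewrite /= ?addn0 addn1.
(* The first [\rank D] rows of [row_ebase D] form a basis of [D]; [pid_mx] keeps them and pads with
   zero rows up to [r]. *)
exists (pid_mx (\rank D) *m row_ebase D).
rewrite -(addsmx_diff_cap_eq X u) addsmx_sub -/D andbC.
rewrite (submx_trans (capmxSr _ _) (addsmxSl _ _)) /=.
apply: submx_trans (addsmxSr _ _).
apply/submxP; exists (col_ebase D *m pid_mx (\rank D)).
by rewrite mulmxA -(mulmxA (col_ebase D)) mul_pid_mx minnn (minn_idPr leD)
  mulmx_ebase.
Qed.

Lemma row_mx_left_factor (m k r : nat) (u : 'cV[F]_m) (X : 'M[F]_(m, k)) :
  (\rank (row_mx u X) + (u == 0%R) <= r.+1)%N ->
  exists (Y : 'M[F]_(m, r)) (R : 'M[F]_(1 + r, k)), X = row_mx u Y *m R.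
Proof.
rewrite -mxrank_tr tr_row_mx -addsmxE -trmx_eq0.
case/submx_row_extension => Y; rewrite addsmxE => /submxP[R eqX].
exists Y^T, R^T; apply: trmx_inj.
by rewrite trmx_mul tr_row_mx !trmxK eqX.
Qed.

End RankLemmas.

Section Completions.
Variable F : fieldType.

Lemma mr_le (m n : nat) (M : 'M[option F]_(m, n)) (A : 'M[F]_(m, n)) :
  completion M A -> (mr M <= \rank A)%N.
Proof.
rewrite /mr; case: ex_minnP => r _ min_r cA.
by apply: min_r; apply/asboolP; exists A.
Qed.

Lemma mr_attained (m n : nat) (M : 'M[option F]_(m, n)) :
  exists2 A : 'M[F]_(m, n), completion M A & \rank A = mr M.
Proof. by rewrite /mr; case: ex_minnP => r /asboolP. Qed.

Lemma completion_row_mx (m n1 n2 : nat) (M1 : 'M[option F]_(m, n1))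
    (M2 : 'M[option F]_(m, n2)) A1 A2 :
  completion (row_mx M1 M2) (row_mx A1 A2) <->
  completion M1 A1 /\ completion M2 A2.
Proof.
split=> [cA|[cA1 cA2] i j a].
  split=> i j a Mij.
    by have := cA i (lshift n2 j) a; rewrite !row_mxEl; apply.
  by have := cA i (rshift n1 j) a; rewrite !row_mxEr; apply.
by rewrite !mxE; case: splitP => l _; [apply: cA1 | apply: cA2].
Qed.

Lemma completion_mxsub (m n p q : nat) (f : 'I_p -> 'I_m) (g : 'I_q -> 'I_n)
    (M : 'M[option F]_(m, n)) A :
  completion M A -> completion (mxsub f g M) (mxsub f g A).
Proof. by move=> cA i j a; rewrite !mxE; apply: cA. Qed.

Lemma completion_mxcol (n p : nat) (m : 'I_n -> nat)
    (M : forall i, 'M[option F]_(m i, p)) (A : forall i, 'M[F]_(m i, p)) :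
  (forall i, completion (M i) (A i)) ->
  completion (\mxcol_(i < n) M i) (\mxcol_(i < n) A i).
Proof. by move=> cA i j a; rewrite !mxE; apply: cA. Qed.

Lemma completion_mxblock (n1 n2 : nat) (m : 'I_n1 -> nat) (k : 'I_n2 -> nat)
    (M : forall i j, 'M[option F]_(m i, k j)) (A : forall i j, 'M[F]_(m i, k j)) :
  (forall i j, completion (M i j) (A i j)) ->
  completion (\mxblock_(i < n1, j < n2) M i j) (\mxblock_(i < n1, j < n2) A i j).
Proof. by move=> cA i j a; rewrite !mxE; apply: cA. Qed.

Lemma diag_blockii (n : nat) (m k : 'I_n -> nat)
    (B : forall i, 'M[option F]_(m i, k i)) i :
  diag_block B i i = B i.
Proof.
by rewrite /diag_block; case: eqP => // e; rewrite (eq_axiomK e) castmx_id.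
Qed.

Lemma completion_diag_block (n : nat) (m k : 'I_n -> nat)
    (B : forall i, 'M[option F]_(m i, k i)) (A : forall i j, 'M[F]_(m i, k j)) :
  (forall i, completion (B i) (A i i)) ->
  forall i j, completion (diag_block B i j) (A i j).
Proof.
move=> cA i j; have [<-|ne_ij] := eqVneq i j; first by rewrite diag_blockii.
rewrite /diag_block; case: eqP => [e|_]; first by rewrite e eqxx in ne_ij.
by move=> s t a; rewrite mxE.
Qed.

(** A rank above the minimum leaves room for [zero v B]; at the minimum, [zero v B = 1] forces
    [u = 0], which contributes the same 1. With [mr_zero_attained], [mr + zero] is the least value
    of the rank plus [u == 0] over all completions. *)
Lemma mr_zero_le (m n : nat) (v : 'cV[option F]_m) (B : 'M[option F]_(m, n))
    (u : 'cV[F]_m) (X : 'M[F]_(m, n)) (r : nat) :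
  completion (row_mx v B) (row_mx u X) ->
  (\rank (row_mx u X) + (u == 0%R) <= r)%N ->
  (mr (row_mx v B) + zero v B <= r)%N.
Proof.
move=> cuX; apply: leq_trans; have := mr_le cuX.
rewrite /zero; case: asboolP => [u0|_] le_mr; last first.
  by rewrite addn0 (leq_trans le_mr) ?leq_addr.
case: ltngtP le_mr => // [lt_mr|eq_mr] _.
  by rewrite addn1 (leq_trans lt_mr) ?leq_addr.
by rewrite eq_mr (u0 _ _ cuX (esym eq_mr)) eqxx.
Qed.

(** If [zero v B] is 1, any completion of minimal rank will do; otherwise one of them has [u]
    nonzero. *)
Lemma mr_zero_attained (m n : nat) (v : 'cV[option F]_m)
    (B : 'M[option F]_(m, n)) :
  exists (u : 'cV[F]_m) (X : 'M[F]_(m, n)),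
    completion (row_mx v B) (row_mx u X) /\
    (\rank (row_mx u X) + (u == 0%R) <= mr (row_mx v B) + zero v B)%N.
Proof.
rewrite /zero; case: asboolP => [_|].
  have [A] := mr_attained (row_mx v B).
  rewrite -[A]hsubmxK => cA rA; exists (lsubmx A), (rsubmx A).
  by split=> //; rewrite rA leq_add2l leq_b1.
move/existsNP=> [u /existsNP[X /not_implyP[cuX /not_implyP[ruX u0]]]].
by exists u, X; split=> //; rewrite ruX; case: eqP.
Qed.

End Completions.

Theorem theorem4p1 (F : fieldType) (n : nat) (n_ge1 : (1 <= n)%N)
    (m k : 'I_n -> nat)
    (v : forall i : 'I_n, 'cV[option F]_(m i))
    (B : forall i : 'I_n, 'M[option F]_(m i, k i))
    (v_not_junk : ~ junk (\mxcol_(i < n) v i)) :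
  mr (shared_column_mx v B) =
  (\max_(i < n) (mr (row_mx (v i) (B i)) + zero (v i) (B i)))%N.
Proof.
apply/eqP; rewrite eqn_leq; apply/andP; split; last first.
  apply/bigmax_leqP => i _; have [A] := mr_attained (shared_column_mx v B).
  rewrite -[A]hsubmxK; set u := lsubmx A; set W := rsubmx A => cA <-.
  have [cu cW] := (completion_row_mx _ _ _ _).1 cA.
  have u0 : u != 0.
    apply: contra_notN v_not_junk => /eqP u0 j.
    case vj: (_ j 0) => [a|]; last by right.
    by left; rewrite -(cu _ _ _ vj) u0 mxE.
  apply: (mr_zero_le (u := submxcol u i) (X := submxblock W i i)).
    apply/completion_row_mx; split.
      by rewrite -(mxcolK v i); apply: completion_mxsub.
    rewrite -(diag_blockii B i) -(mxblockK (diag_block B) i i).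
    exact: completion_mxsub.
  exact: mxrank_mxsub_row_mx.
set r := \max_(i < n) _.
have le_r i : (mr (row_mx (v i) (B i)) + zero (v i) (B i) <= r)%N.
  exact: (leq_bigmax i).
(* Each [u i] takes one of the [r] columns, leaving [r.-1] for the rest. Positivity holds because a
   nonzero [u] already gives positive rank, while a zero one adds 1. *)
have r_gt0 : (0 < r)%N.
  have [u [X [_ /leq_trans/(_ (le_r (Ordinal n_ge1)))]]] :=
    mr_zero_attained (v (Ordinal n_ge1)) (B (Ordinal n_ge1)).
  case: eqP => [_|u0]; first by rewrite addn1; apply: leq_ltn_trans.
  rewrite addn0; apply: leq_trans; rewrite lt0n mxrank_eq0.
  by apply: contra_notN u0 => /eqP; rewrite -row_mx0 => /eq_row_mx[].
have block i : {uYR : 'cV[F]_(m i) * 'M[F]_(m i, r.-1) * 'M[F]_(1 + r.-1, k i) |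
    completion (v i) uYR.1.1 /\
    completion (B i) (row_mx uYR.1.1 uYR.1.2 *m uYR.2)}.
  apply: cid; have [u [X [cuX rk]]] := mr_zero_attained (v i) (B i).
  have := leq_trans rk (le_r i); rewrite -[X in (_ <= X)%N](prednK r_gt0).
  case/row_mx_left_factor => Y [R eqX]; exists (u, Y, R) => /=.
  by rewrite -eqX; apply/completion_row_mx.
pose u i := (sval (block i)).1.1.
pose L i := row_mx (u i) (sval (block i)).1.2.
pose R i := (sval (block i)).2.
(* The factor [col_mx 1%:M 0] picks the column [u i] out of each [L i]. Block [(i, j)] of the rest
   is [L i *m R j], which is constrained only for [i = j]. *)
pose A := \mxcol_i L i *m row_mx (col_mx 1%:M 0) (\mxrow_j R j).
have cA : completion (shared_column_mx v B) A.
  rewrite /A mul_mx_row mul_mxcol_mxrow mxcol_mul.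
  apply/completion_row_mx; split.
    apply: completion_mxcol => i.
    by rewrite mul_row_col mulmx1 mulmx0 addr0; case: (svalP (block i)).
  apply/completion_mxblock/completion_diag_block => i.
  by case: (svalP (block i)).
(* The left factor of [A] has [1 + r.-1 = r] columns. *)
apply: leq_trans (mr_le cA) (leq_trans (mxrankM_maxl _ _) _).
by rewrite (leq_trans (rank_leq_col _)) // add1n prednK.
Qed.
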